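(* For any integer $r\geq 3$, we have $\lfloor \sqrt{r/2}\rfloor\leq g(r)\leq 2r-3$.
   Context: A hypergraph $\mathcal{H}$ consists of a finite vertex set $V(\mathcal{H})$ and a set $E(\mathcal{H})$ of subsets of $V(\mathcal{H})$, called edges. It is $r$-uniform if every edge has exactly $r$ vertices. The degree $\deg_{\mathcal{H}} v$ of a vertex $v$ is the number of edges containing $v$; $\mathcal{H}$ is $d$-regular if every vertex has degree $d$. A spanning subhypergraph $\mathcal{C}\subseteq\mathcal{H}$ is a hypergraph with $V(\mathcal{C})=V(\mathcal{H})$ and $E(\mathcal{C})\subseteq E(\mathcal{H})$. For $r\geq 2$, $g(r)$ denotes the smallest integer $t$ such that for any integers $d\geq k\geq 1$ and any $d$-regular $r$-uniform hypergraph $\mathcal{H}$, there exists a spanning subhypergraph $\mathcal{C}\subseteq \mathcal{H}$ such that for every vertex $v\in V(\mathcal{H})$ we have $\deg_{\mathcal{C}} v\in \{k, k+1, \dots, k+t-1\}$. *)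

(* Defs.v *)
From mathcomp Require Import all_boot all_order all_algebra.
From mathcomp Require Import reals.
Set Implicit Arguments.
Unset Strict Implicit.
Unset Printing Implicit Defensive.
Import Order.TTheory GRing.Theory Num.Theory.

(* A hypergraph with vertex set V is its set of edges; in particular there are
   no repeated edges.  A spanning subhypergraph of H is then a subset of H. *)
Definition hypergraph (V : finType) := {set {set V}}.

Definition deg (V : finType) (H : hypergraph V) (v : V) : nat :=
  #|[set e in H | v \in e]|.

Definition uniform (V : finType) (r : nat) (H : hypergraph V) : Prop :=
  forall e : {set V}, e \in H -> #|e| = r.

Definition regular (V : finType) (d : nat) (H : hypergraph V) : Prop :=
  forall v : V, deg H v = d.

Definition spanning_sub (V : finType) (C H : hypergraph V) : Prop :=
  C \subset H.

Definition window (r : nat) (t : int) : Prop :=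
  forall d k : nat, 1 <= k -> k <= d ->
  forall (V : finType) (H : hypergraph V), regular d H -> uniform r H ->
  exists C : hypergraph V, spanning_sub C H /\
    forall v : V, (k%:Z <= (deg C v)%:Z <= k%:Z + t - 1)%R.

(* [is_g r t] says that g(r) exists and equals t. *)
Definition is_g (r : nat) (t : int) : Prop :=
  window r t /\ forall s : int, window r s -> (t <= s)%R.

(* Main.v *)
(* Upper bound: Beck-Fiala rounding.  Give every edge the weight s/d with
   s = k + r - 2, so that every vertex has weighted degree s, and move the weights
   to 0 or 1 while freezing the weighted degree of each vertex which could still
   end at distance more than r - 2 from s.  Such a vertex lies on at least r
   floating edges, so double counting leaves at least as many floating edges as
   constraints.  The only obstruction is an invertible square system in which all
   constrained vertices lie on exactly r floating edges; there each of them has a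
   single bad outcome (all r edges rounded to 1, or all to 0), and inverting the
   system moves all of them strictly away from it at once.

   Lower bound: in the affine plane of order Q = 2^n with Q < r <= 2Q, take the
   lines as vertices and the points as edges.  If all degrees of a subhypergraph
   were within g of k + g = Q/2, the second moment over the lines would give
   Q^2 <= (Q + 1) (2g)^2.  Padding Q disjoint copies makes the hypergraph
   r-uniform. *)
Require Import Defs.
From mathcomp Require Import all_boot all_order all_algebra.
From mathcomp Require Import all_field.
From mathcomp Require Import reals boolp.
From mathcomp Require Import zify ring lra.
Set Implicit Arguments.
Unset Strict Implicit.
Unset Printing Implicit Defensive.
Import Order.TTheory GRing.Theory Num.Theory.

(** * Double counting and linear algebra for the rounding *)

Lemma sum_deg (V : finType) (H : hypergraph V) (A : {set V}) :
  \sum_(v in A) deg H v = \sum_(e in H) #|e :&: A|.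
Proof.
have -> : \sum_(v in A) deg H v = \sum_(v in A) \sum_(e in H) (v \in e : nat).
  apply: eq_bigr => v _; rewrite /deg -sum1_card (eq_bigl (fun e => (e \in H) && (v \in e))).
    by rewrite big_mkcondr; apply: eq_bigr => e _; case: (v \in e).
  by move=> e; rewrite inE.
rewrite exchange_big; apply: eq_bigr => e _ /=.
rewrite -sum1_card [RHS](eq_bigl (fun v => (v \in A) && (v \in e))).
  by rewrite big_mkcondr; apply: eq_bigr => v _; case: (v \in e).
by move=> v; rewrite inE andbC.
Qed.

(** The matrix of [a] with rows in [F] and columns in [U] either has a nonzero left kernel or has
    rank [#|F|], and then it is invertible when square. *)
Lemma kernel_or_solvable (K : fieldType) (E V : finType) (F : {set E})
    (U : {set V}) (a : E -> V -> K) :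
  (exists y : E -> K, [/\ forall e, e \notin F -> y e = 0%R,
     exists2 e, e \in F & y e != 0%R &
     forall v, v \in U -> (\sum_(e in F) y e * a e v = 0)%R]) \/
  #|F| <= #|U| /\ (#|F| = #|U| -> forall w : V -> K,
   exists2 y : E -> K, (forall e, e \notin F -> y e = 0%R) &
     forall v, v \in U -> (\sum_(e in F) y e * a e v = w v)%R).
Proof.
pose A : 'M[K]_(#|F|, #|U|) := (\matrix_(i, j) a (enum_val i) (enum_val j))%R.
have [/set0Pn [e0 e0F]|] := boolP (F != set0); last first.
  rewrite negbK => /eqP F0; right; rewrite F0 cards0; split=> // U0 w.
  exists (fun=> 0%R) => // v vU; move: U0 => /esym/eqP.
  by rewrite cards_eq0 => /eqP U0; rewrite U0 inE in vU.
pose ext (y : 'rV[K]_#|F|) e :=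
  if e \in F then y 0%R (enum_rank_in e0F e) else 0%R.
have extN y e : e \notin F -> ext y e = 0%R by rewrite /ext => /negbTE ->.
have extE y v (vU : v \in U) :
    (\sum_(e in F) ext y e * a e v = (y *m A) 0 (enum_rank_in vU v))%R.
  rewrite mxE (reindex_onto (@enum_val _ (mem F)) (enum_rank_in e0F)) /=; last first.
    by move=> e eF; rewrite enum_rankK_in.
  rewrite (eq_bigl predT); last by move=> i; rewrite enum_valP enum_valK_in eqxx.
  apply: eq_bigr => i _; rewrite /ext enum_valP enum_valK_in mxE.
  by rewrite (enum_rankK_in vU).
have [/row_freeP|nfree] := boolP (row_free A).
  move=> /row_freeP freeA; right; move: (freeA) => /eqP rkA.
  split; first by rewrite -[X in X <= _]rkA rank_leq_col.
  move=> eqFU w; have fullA : row_full A by rewrite /row_full rkA eqFU.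
  have /submxP [y yE] := submx_full (\row_j w (enum_val j))%R fullA.
  exists (ext y) => [e /extN //|v vU].
  by rewrite (extE y v vU) -yE mxE (enum_rankK_in vU).
left; have kerA : kermx A != 0%R by rewrite kermx_eq0.
have /rowV0Pn [y yker y0] := kerA.
exists (ext y); split=> [e /extN //||v vU].
  have [i yi] : exists i, y 0%R i != 0%R.
    by have /rV0Pn := y0.
  by exists (enum_val i); rewrite ?enum_valP// /ext enum_valP enum_valK_in.
by rewrite (extE y v vU) (sub_kermxP yker) mxE.
Qed.

Lemma move_to_boundary (K : realFieldType) (E : finType) (F : {set E})
    (x y : E -> K) :
  (forall e, e \in F -> 0 < x e < 1)%R -> (exists2 e, e \in F & y e != 0%R) ->
  exists t : K, [/\ (0 < t)%R,
    forall e, e \in F -> (0 <= x e + t * y e <= 1)%R &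
    exists2 e, e \in F & (x e + t * y e == 0)%R || (x e + t * y e == 1)%R].
Proof.
move=> xF [e0 e0F ye0].
(* [b e] is the time at which coordinate [e], moving along [y], leaves the unit interval; the
   smallest such time serves as [t]. *)
pose b e : K := (if 0 < y e then (1 - x e) / y e else x e / - y e)%R.
pose P := [pred e | (e \in F) && (y e != 0%R)].
have Pe0 : P e0 by rewrite /= e0F.
have [e /= /andP[eF ye] emin] := arg_minP b Pe0.
have bE f : f \in F -> y f != 0%R -> (0 < b f)%R.
  move=> fF yf; have := xF f fF; rewrite /b; case: (ltP 0%R (y f)) => yf0 xf.
    by apply: divr_gt0; lra.
  by apply: divr_gt0; [lra|]; rewrite oppr_gt0 lt_neqAle yf.
exists (b e); split; first exact: bE.
  move=> f fF; have := xF f fF => xf.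
  have [->|yf] := eqVneq (y f) 0%R; first by lra.
  have b0 := bE e eF ye; have := emin f; rewrite /= fF yf => /(_ isT).
  rewrite [leRHS]/b; case: (ltP 0%R (y f)) => yf0.
    rewrite ler_pdivlMr // => h; have := mulr_ge0 (ltW b0) (ltW yf0); lra.
  have yf1 : (0 < - y f)%R by rewrite oppr_gt0 lt_neqAle yf.
  rewrite ler_pdivlMr // => h; have := mulr_ge0 (ltW b0) (ltW yf1); lra.
exists e => //; rewrite /b; case: (ltP 0%R (y e)) => ye0'.
  by rewrite divfK // addrC subrK eqxx orbT.
by rewrite invrN mulrN mulNr divfK // subrr eqxx.
Qed.

(** * Beck-Fiala rounding and the upper bound *)

Section Rounding.
Variables (V : finType) (r s : nat).
Hypothesis r3 : 3 <= r.
Implicit Types (x y : {set V} -> rat) (v : V) (e : {set V}).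

Definition ones x : hypergraph V := [set e | x e == 1%R].
Definition floating x : hypergraph V := [set e | (0 < x e < 1)%R].
Definition fdeg x v : rat := (\sum_(e : {set V} | v \in e) x e)%R.

(** The two conditions concern the extreme outcomes: all floating edges rounded to 0, and all
    rounded to 1. *)
Definition safe x v :=
  (s <= deg (ones x) v + (r - 2)) &&
  (deg (ones x) v + deg (floating x) v <= s + (r - 2)).

(* The last two alternatives describe a vertex that was released while [r] of
   its edges were floating: only one outcome of the rounding is bad for it, and
   the strict inequality on [fdeg] excludes that outcome. *)
Definition good x v :=
  [\/ safe x v, fdeg x v = (s%:R)%R,
   [/\ deg (floating x) v <= r, (deg (ones x) v).+1 = s & (fdeg x v < s%:R)%R] |
   [/\ deg (floating x) v <= r, deg (ones x) v + deg (floating x) v = s.+1 &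
       (s%:R < fdeg x v)%R]].

Definition unit_valued x := forall e, (0 <= x e <= 1)%R.

Lemma fdegE x v : unit_valued x ->
  (fdeg x v = (deg (ones x) v)%:R + \sum_(e in floating x | v \in e) x e)%R.
Proof.
move=> x01; rewrite /fdeg (bigID [pred e | x e == 1%R]) /=; congr (_ + _)%R.
  rewrite (eq_bigr (fun=> 1%R)); last by move=> e /andP[_ /eqP].
  rewrite /deg -sum1_card natr_sum; apply: eq_bigl => e.
  by rewrite !inE andbC.
rewrite (bigID [pred e | x e == 0%R]) /= big1 ?add0r; last by move=> e /andP[_ /eqP].
apply: eq_bigl => e; rewrite inE !lt_neqAle; case/andP: (x01 e) => -> ->.
by rewrite !andbT [0%R == _]eq_sym -andbA andbC [in RHS]andbC; case: (v \in e);
  rewrite ?andbT ?andbF // andbC.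
Qed.

Lemma fdeg_bounds x v : unit_valued x ->
  ((deg (ones x) v)%:R <= fdeg x v <= (deg (ones x) v + deg (floating x) v)%:R)%R.
Proof.
move=> x01; rewrite fdegE // natrD lerD2l lerDl; apply/andP; split.
  by apply: sumr_ge0 => e _; case/andP: (x01 e).
rewrite /deg -sum1_card natr_sum [leRHS](eq_bigl (fun e => (e \in floating x) && (v \in e))).
  by apply: ler_sum => e _; case/andP: (x01 e).
by move=> e; rewrite [LHS]inE.
Qed.

Lemma fdeg_bounds_strict x v : unit_valued x -> 0 < deg (floating x) v ->
  ((deg (ones x) v)%:R < fdeg x v < (deg (ones x) v + deg (floating x) v)%:R)%R.
Proof.
move=> x01; rewrite card_gt0 => /set0Pn [e0]; rewrite inE => e0F.
have /andP[e0fl _] := e0F.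
have /andP[lo hi] : (0 < x e0 < 1)%R by move: e0fl; rewrite inE.
rewrite fdegE // natrD ltrD2l ltrDl; apply/andP; split.
  rewrite (bigD1 e0) //=; apply: ltr_wpDr => //.
  by apply: sumr_ge0 => e _; case/andP: (x01 e).
rewrite /deg -sum1_card natr_sum [ltRHS](eq_bigl (fun e => (e \in floating x) && (v \in e))).
  rewrite (bigD1 e0) //= [ltRHS](bigD1 e0) //=; apply: ltr_leD => //.
  by apply: ler_sum => e _; case/andP: (x01 e).
by move=> e; rewrite [LHS]inE.
Qed.

(** If [fdeg x v] is [s] and some edge at [v] floats, [s] lies strictly between the two extreme
    outcomes; strictness gains one on each side, so fewer than [r] floating edges already make [v]
    safe. *)
Lemma unsafe_deg x v : unit_valued x -> good x v -> ~~ safe x v ->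
  r <= deg (floating x) v.
Proof.
move=> x01 gv; apply: contraR; rewrite -ltnNge => ur.
case: gv => // [sumv|[_ o1 _]|[_ o1 _]]; rewrite /safe; [|lia..].
have := fdeg_bounds v x01; have := @fdeg_bounds_strict x v x01.
rewrite sumv !ltr_nat !ler_nat; case: (deg (floating x) v) ur => [|u] ur; last first.
  by move=> /(_ isT); lia.
lia.
Qed.

Lemma round_step x : unit_valued x -> (forall e, e \in floating x -> #|e| <= r) ->
  (forall v, good x v) -> floating x != set0 ->
  exists x', [/\ unit_valued x', forall v, good x' v, floating x' \proper floating x &
    forall e, x e = 0%R -> x' e = 0%R].
Proof.
move=> x01 xr gx F0.
set F := floating x; pose U := [set v | ~~ safe x v].
have Udeg v : v \in U -> r <= deg F v by rewrite inE; exact: unsafe_deg.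
have leFr : \sum_(v in U) deg F v <= #|F| * r.
  rewrite sum_deg -sum_nat_const; apply: leq_sum => e /xr; apply: leq_trans.
  exact/subset_leq_card/subsetIl.
have leU : #|U| * r <= \sum_(v in U) deg F v.
  by rewrite -sum_nat_const; apply: leq_sum.
have leUF : #|U| <= #|F| by rewrite -(leq_pmul2r (_ : 0 < r)) ?(leq_trans leU)//; lia.
have Fx e : e \in F -> (0 < x e < 1)%R by rewrite inE.
(* The direction [y] must freeze each unsafe vertex or, if exactly [r] of its edges float, push it
   away from its one bad outcome. *)
suff [y [yF [e0 e0F ye0] yU]] : exists y : {set V} -> rat,
   [/\ forall e, e \notin F -> y e = 0%R, exists2 e, e \in F & y e != 0%R &
    forall v, v \in U -> fdeg y v = 0%R \/ deg F v = r /\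
     ((deg (ones x) v).+1 = s /\ (fdeg x v <= s%:R)%R /\ (fdeg y v < 0)%R \/
      deg (ones x) v + r = s.+1 /\ (s%:R <= fdeg x v)%R /\ (0 < fdeg y v)%R)].
  have [|t [t0 tb [e1 e1F e1b]]] := move_to_boundary Fx (y := y); first by exists e0.
  pose x' e := (x e + t * y e)%R.
  have x'N e : e \notin F -> x' e = x e by move=> /yF; rewrite /x' => ->; rewrite mulr0 addr0.
  have x'01 : unit_valued x'.
    by move=> e; have [/tb//|/x'N ->] := boolP (e \in F).
  have subF : floating x' \subset F.
    apply/subsetP => e; rewrite inE => x'e; apply: contraT => eF.
    by move: x'e (eF); rewrite x'N // inE => ->.
  have subO : ones x \subset ones x'.
    apply/subsetP => e; rewrite !inE => xe1; rewrite x'N // inE (eqP xe1).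
    by rewrite ltxx andbF.
  have subOF : ones x' :|: floating x' \subset ones x :|: F.
    rewrite subUset (subset_trans subF (subsetUr _ _)) andbT.
    apply/subsetP => e; rewrite !inE; case: (boolP (e \in F)) => [|eF].
      by rewrite inE => -> ; rewrite orbT.
    by rewrite x'N // => ->.
  have degS (A B : hypergraph V) v : A \subset B -> deg A v <= deg B v.
    move=> AB; apply: subset_leq_card; apply/subsetP => e; rewrite !inE.
    by case/andP => /(subsetP AB) -> ->.
  have degU z v : deg (ones z :|: floating z) v = deg (ones z) v + deg (floating z) v.
    rewrite /deg -cardsUI [X in _ = _ + #|pred_of_set X|](_ : _ = set0).
      by rewrite cards0 addn0; apply: eq_card => e; rewrite !inE andb_orl.
    apply/setP => e; rewrite !inE.
    by case: eqP => //= ->; rewrite ltxx andbF /= andbF.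
  have dF v := degS _ _ v subF; have dO v := degS _ _ v subO.
  have dOF v := degS _ _ v subOF.
  have fdegx' v : fdeg x' v = (fdeg x v + t * fdeg y v)%R.
    by rewrite /fdeg mulr_sumr -big_split.
  exists x'; split=> //.
  - move=> v; move: (dF v) (dO v) (dOF v); rewrite !degU -/F => h1 h2 h3.
    have [sv|nsv] := boolP (safe x v).
      constructor 1; case/andP: sv => s1 s2; apply/andP; split.
        by apply: leq_trans s1 _; rewrite leq_add2r.
      exact: leq_trans h3 s2.
    have vU : v \in U by rewrite inE.
    have := fdeg_bounds v x'01 => /andP[b1 b2].
    (* The number of ones at [v] is at most [fdeg x' v], hence below [s], and was already [s - 1]:
       an edge that stops floating here goes to 0. [keepH] is the mirror image. *)
    have keepL : deg F v <= r -> (deg (ones x) v).+1 = s -> (fdeg x' v < s%:R)%R -> good x' v.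
      move=> ur o1 lt1; constructor 3; split => //; first exact: leq_trans h1 ur.
      have := le_lt_trans b1 lt1; rewrite ltr_nat => lt_s; apply/eqP.
      by rewrite eqn_leq lt_s -o1 ltnS h2.
    have keepH : deg F v <= r -> deg (ones x) v + deg F v = s.+1 -> (s%:R < fdeg x' v)%R -> good x' v.
      move=> ur o1 lt1; constructor 4; split => //; first exact: leq_trans h1 ur.
      have := lt_le_trans lt1 b2; rewrite ltr_nat => lt_s; apply/eqP.
      by rewrite eqn_leq lt_s -o1 h3.
    case: (yU v vU) => [y0|[ur [[o1 [le1 y0]]|[o1 [le1 y0]]]]].
    + have xx : fdeg x' v = fdeg x v by rewrite fdegx' y0 mulr0 addr0.
      case: (gx v) => [sv|sv|[ur o1 lt1]|[ur o1 lt1]].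
      * by rewrite sv in nsv.
      * by constructor 2; rewrite xx.
      * by apply: keepL => //; rewrite xx.
      * by apply: keepH => //; rewrite xx.
    + apply: keepL; rewrite ?ur //; rewrite fdegx'.
      have : (t * fdeg y v < 0)%R by rewrite pmulr_rlt0.
      lra.
    + apply: keepH; rewrite ?ur //; rewrite fdegx'.
      have : (0 < t * fdeg y v)%R by rewrite pmulr_rgt0.
      lra.
  - rewrite properE subF; apply/subsetPn; exists e1 => //.
    rewrite inE; case/orP: e1b => /eqP; rewrite /x' => ->; by rewrite ltxx ?andbF.
  - by move=> e xe0; rewrite x'N // inE xe0 ltxx.
have fdegF y v : (forall e, e \notin F -> y e = 0%R) ->
    fdeg y v = (\sum_(e in F) y e * (v \in e)%:R)%R.
  move=> yF; rewrite /fdeg (bigID (mem F)) /= [X in (_ + X)%R]big1 ?addr0; last first.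
    by move=> e /andP[_ /yF].
  rewrite big_andbC big_mkcondr; apply: eq_bigr => e _.
  by case: (v \in e); rewrite ?mulr1 ?mulr0.
have [[y [yF yn yU]]|[leFU solve]] :=
    kernel_or_solvable F U (fun e v => (v \in e)%:R : rat)%R.
  by exists y; split=> // v vU; left; rewrite fdegF // yU.
(* The double count is now tight, which forces exactly [r] floating edges at every unsafe vertex. *)
have eqFU : #|F| = #|U| by apply/eqP; rewrite eqn_leq leFU.
have degr v : v \in U -> deg F v = r.
  move=> vU; apply/eqP; rewrite eqn_leq Udeg // andbT leqNgt; apply/negP => ltr.
  move: leFr; rewrite leqNgt eqFU -sum_nat_const => /negP; apply.
  rewrite (bigD1 v) //= [X in _ < X](bigD1 v) //= -addSn leq_add //.
  by apply: leq_sum => w /andP[/Udeg].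
(* The sign is -1 where rounding all [r] edges to 1 is bad, and 1 where rounding all to 0 is bad. *)
have [y yF yE] := solve eqFU (fun v => if (deg (ones x) v).+1 == s then -1 else 1)%R.
have yU v : v \in U -> fdeg y v = (if (deg (ones x) v).+1 == s then -1 else 1)%R.
  by move=> vU; rewrite fdegF // yE.
exists y; split=> //.
  have : U != set0 by rewrite -card_gt0 -eqFU card_gt0.
  case/set0Pn => v vU; have [/existsP [e /andP[]]|] := boolP [exists e, (e \in F) && (y e != 0%R)].
    by exists e.
  rewrite negb_exists => /forallP y0; have := yU v vU.
  rewrite fdegF // big1; first by case: ifP.
  by move=> e eF; have := y0 e; rewrite eF /= negbK => /eqP ->; rewrite mul0r.
move=> v vU; right; rewrite yU // degr //; split=> //.
have := vU; rewrite inE /safe -/F degr // => nsv.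
have := fdeg_bounds_strict (v := v) x01; rewrite -/F degr // => /(_ (ltnW (ltnW r3)))/andP[].
case: (gx v) => [sv|sv|[_ o1 lt1]|[_ o1 lt1]] b1 b2.
- by move: sv nsv; rewrite /safe -/F degr // => ->.
- move: b1 b2; rewrite sv !ltr_nat lexx => b1 b2.
  by case: eqP => o1; [left|right]; split => //; move: nsv b1 b2 o1 r3; clear; lia.
- by left; rewrite o1 eqxx; rewrite ltW.
- right; move: o1; rewrite -/F degr // => o1; rewrite (ltW lt1) o1; split=> //; split=> //.
  (* Both signs would be demanded at once only if [r] were 2. *)
  by case: eqP => // o2; move: o1 o2 r3; clear; lia.
Qed.

Lemma round_exists x : unit_valued x -> (forall e, x e != 0%R -> #|e| <= r) ->
  (forall v, good x v) ->
  exists C : hypergraph V, (forall e, e \in C -> x e != 0%R) /\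
    forall v, s <= deg C v + (r - 2) /\ deg C v <= s + (r - 2).
Proof.
have [n] := ubnP #|floating x|; elim: n x => // n IH x ltn x01 xr gx.
have [F0|F0] := eqVneq (floating x) set0.
  exists (ones x); split=> [e|v]; first by rewrite inE => /eqP ->.
  have u0 : deg (floating x) v = 0 by rewrite F0 /deg; apply: eq_card0 => e; rewrite !inE.
  (* Without floating edges, an unsafe vertex would give [r <= 0]. *)
  have : safe x v by apply: contraT => /(unsafe_deg x01 (gx v)); rewrite u0; lia.
  by rewrite /safe u0; lia.
have [|x' [x'01 gx' /proper_card ltF x0]] := round_step x01 _ gx F0.
  by move=> e; rewrite inE => /andP[x0 _]; apply: xr; rewrite gt_eqF.
have x'0 e : x' e != 0%R -> x e != 0%R by apply: contraNneq => /x0 ->.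
have [|e /x'0/xr //|C [Cx Cs]] := IH x' _ x'01 _ gx'.
  exact: leq_trans ltF ltn.
by exists C; split=> // e /Cx/x'0.
Qed.

End Rounding.

Lemma window_upper (r : nat) : 3 <= r -> window r (2 * r%:Z - 3)%R.
Proof.
move=> r3 d k k1 kd V H Hd Hr.
(* For small [d], [H] itself works; otherwise [s / d] is at most 1, and the window is the interval
   of radius [r - 2] about [s]. *)
have [le_d|lt_d] := leqP d (k + (2 * r - 4)).
  by exists H; split=> [|v]; rewrite /spanning_sub // Hd; lia.
pose s := k + (r - 2).
pose x (e : {set V}) : rat := if e \in H then (s%:R / d%:R)%R else 0%R.
have d0 : (0 < d%:R :> rat)%R by rewrite ltr0n; lia.
have x01 : unit_valued x.
  move=> e; rewrite /x; case: ifP => // _; rewrite divr_ge0 ?ler0n //=.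
  by rewrite ler_pdivrMr // mul1r ler_nat; lia.
have [e|v|C [Cx Cs]] := round_exists (s := s) r3 x01.
- by rewrite /x; case: ifP => [/Hr ->|]; rewrite ?eqxx.
- constructor 2; rewrite /fdeg -big_mkcondr /= sumr_const.
  rewrite (_ : #|_| = d); last by rewrite -(Hd v); apply: eq_card => e; rewrite !inE andbC.
  by rewrite -[LHS]mulr_natr divfK // gt_eqF.
exists C; split=> [|v]; last by have := Cs v; lia.
apply/subsetP => e /Cx; rewrite /x; case: ifP => //; by rewrite eqxx.
Qed.

(** * Second moment of line counts in the affine plane *)

Section AffinePlane.
Variable F : finFieldType.
Implicit Types (p : F * F) (o : option F).

(* The lines of the affine plane are the pairs [(o, b)] of a slope ([None] for
   the vertical direction) and an intercept; [intercept o p] is the intercept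
   of the line of slope [o] through [p]. *)
Definition intercept o p : F :=
  if o is Some a then (p.2 - a * p.1)%R else p.1.

Lemma card_line o b : #|[set p | intercept o p == b]| = #|F|.
Proof.
pose f (z : F) : F * F := if o is Some a then (z, b + a * z)%R else (b, z).
rewrite -(card_codom (f := f)); last by move=> z z'; rewrite /f {f}; case: o => [a|] [].
apply: eq_card => p; rewrite inE; apply/eqP/codomP => [|[z ->]].
  rewrite /f {f}; case: o p => [a|] [u w] /= <-; last by exists w.
  by exists u; rewrite subrK.
by rewrite /f {f}; case: o => [a|] //=; rewrite addrK.
Qed.

Lemma card_common_slopes p p' :
  #|[set o | intercept o p == intercept o p']| = if p == p' then #|F|.+1 else 1.
Proof.
case: eqP => [->|/eqP neq_p].
  by rewrite -card_option -cardsT; apply: eq_card => o; rewrite !inE eqxx.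
case: p p' neq_p => [u w] [u' w'] neq.
pose o0 := if u == u' then None else Some ((w - w') / (u - u'))%R.
rewrite -(cards1 o0); apply: eq_card => -[a|]; rewrite !inE /o0 /=.
  have [equ|nequ] := eqVneq u u'.
    rewrite equ in neq *; rewrite (inj_eq (addIr _)).
    by apply/negbTE; apply: contraNneq neq => ->.
  have d0 : (u - u' != 0)%R by rewrite subr_eq0.
  rewrite (_ : (Some a == _) = (a == (w - w') / (u - u'))%R) //.
  apply/eqP/eqP => [h|->]; last by field.
  apply: (mulIf d0); rewrite divfK //.
  by rewrite -[w in RHS](subrK (a * u)%R) h; ring.
by case: (eqVneq u u').
Qed.

Definition line_count (D : {set F * F}) o b : nat :=
  #|[set p in D | intercept o p == b]|.

Lemma line_countE D o b :
  line_count D o b = \sum_(p in D) (intercept o p == b).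
Proof.
rewrite /line_count -sum1_card (eq_bigl (fun p => (p \in D) && (intercept o p == b))).
  by rewrite big_mkcondr; apply: eq_bigr => p _; case: eqP.
by move=> p; rewrite inE.
Qed.

Lemma sum_line_count D : \sum_o \sum_b line_count D o b = #|D| * #|F|.+1.
Proof.
have -> : \sum_o \sum_b line_count D o b = \sum_(o : option F) #|D|.
  apply: eq_bigr => o _; under eq_bigr do rewrite line_countE.
  rewrite exchange_big -sum1_card; apply: eq_bigr => p _ /=.
  by rewrite (bigD1 (intercept o p)) //= eqxx big1 // => b /negbTE; rewrite eq_sym => ->.
by rewrite sum_nat_const card_option mulnC.
Qed.

(** Counts pairs of points of [D] with a common line: a pair of equal points has [#|F|.+1] of them,
    any other pair one. *)
Lemma sum_line_count_sqr D :
  \sum_o \sum_b line_count D o b ^ 2 = #|D| * #|F| + #|D| ^ 2.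
Proof.
have -> : \sum_o \sum_b line_count D o b ^ 2 =
    \sum_(p in D) \sum_(p' in D) #|[set o | intercept o p == intercept o p']|.
  transitivity (\sum_(o : option F) \sum_(p in D) \sum_(p' in D)
      (intercept o p == intercept o p' : nat)).
    apply: eq_bigr => o _.
    under eq_bigr do rewrite line_countE -mulnn big_distrl /=.
    rewrite exchange_big; apply: eq_bigr => p _ /=.
    under eq_bigr do rewrite big_distrr /=.
    rewrite exchange_big; apply: eq_bigr => p' _ /=.
    rewrite (bigD1 (intercept o p)) //= eqxx mul1n big1 ?addn0 1?eq_sym //.
    by move=> b /negbTE; rewrite eq_sym => ->.
  rewrite exchange_big; apply: eq_bigr => p _ /=.
  rewrite exchange_big; apply: eq_bigr => p' _ /=.
  by rewrite -sum1_card [RHS]big_mkcond; apply: eq_bigr => o _; rewrite inE; case: eqP.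
under eq_bigr do under eq_bigr do rewrite card_common_slopes.
transitivity (\sum_(p in D) (#|F| + #|D|)); last by rewrite sum_nat_const; lia.
apply: eq_bigr => p pD; rewrite (bigD1 p) //= eqxx.
rewrite (eq_bigr (fun=> 1)); last by move=> p' /andP[_]; rewrite eq_sym => /negbTE ->.
by rewrite sum1_card (cardsD1 p D) pD addSn addnS; congr (_ + _).+1;
  apply: eq_card => p'; rewrite !inE andbC.
Qed.

(* Second moment method: any two distinct points lie on exactly one common line,
   so the sum of the squared line counts depends only on [#|D|]. *)
Lemma line_count_deviation (D : {set F * F}) (M g : nat) : #|F| = M.*2 ->
  (forall o b, M <= line_count D o b + g /\ line_count D o b <= M + g) ->
  #|F| ^ 2 <= #|F|.+1 * (4 * g ^ 2).
Proof.
set Q := #|F| => QM close.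
have Q0 : 0 < Q by apply/card_gt0P; exists 0%R.
(* Termwise this is [(line_count D o b - M) ^ 2 <= g ^ 2], expanded without subtraction using
   [Q = 2 * M]. *)
have bound : \sum_(o : option F) \sum_(b : F) (line_count D o b ^ 2 + M ^ 2) <=
    \sum_(o : option F) \sum_(b : F) (line_count D o b * Q + g ^ 2).
  apply: leq_sum => o _; apply: leq_sum => b _.
  by have [h1 h2] := close o b; rewrite QM; nia.
have big_const c : \sum_(o : option F) \sum_(b : F) c = Q.+1 * (Q * c).
  by rewrite !sum_nat_const card_option.
have split_sum (f h : option F -> F -> nat) : \sum_o \sum_b (f o b + h o b) =
    \sum_o \sum_b f o b + \sum_o \sum_b h o b.
  by rewrite -big_split; apply: eq_bigr => o _; rewrite -big_split.
move: bound; rewrite !split_sum !big_const sum_line_count_sqr.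
have -> : \sum_o \sum_b line_count D o b * Q = #|D| * Q.+1 * Q.
  rewrite -sum_line_count big_distrl; apply: eq_bigr => o _.
  by rewrite big_distrl.
move: #|D| => c; rewrite -/Q; clear close.
move=> bound.
suff : Q * Q ^ 2 <= Q * (Q.+1 * (4 * g ^ 2)) by rewrite leq_pmul2l.
(* Four times [bound] rearranges to [Q ^ 3 + (2 * c - Q ^ 2) ^ 2 <= 4 * Q * Q.+1 * g ^ 2]. *)
have sq : (0 <= (2 * c%:Z - Q%:Z ^+ 2) ^+ 2)%R by rewrite sqr_ge0.
nia.
Qed.

(** * The padded hypergraph *)

Section Padding.
Variable m : nat.

(** [inl (i, (o, b))] is a line in copy [i] of the plane; [inr (p, j)] is the padding vertex number
    [j] of the point [p]. *)
Definition pad_vertex : finType := ((F * (option F * F)) + ((F * F) * 'I_m))%type.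

(* The [#|F|] copies of the point [p] share the padding vertices
   [inr (p, j)], which thus have degree [#|F|] like the lines. *)
Definition pad_edge (z : F * (F * F)) : {set pad_vertex} :=
  [set v : pad_vertex | match v with
     | inl (i, (o, b)) => (i == z.1) && (intercept o z.2 == b)
     | inr (p, j) => p == z.2
     end].

Definition pad_graph : hypergraph pad_vertex := [set pad_edge z | z in setT].

(** A point is recovered from its vertical and horizontal lines. Since edges form a set, this keeps
    distinct points from merging. *)
Lemma pad_edge_inj : injective pad_edge.
Proof.
move=> [i [u w]] [i' [u' w']] eqE.
have /esym := congr1 (fun A : {set pad_vertex} => inl (i, (None, u)) \in A) eqE.
have /esym := congr1 (fun A : {set pad_vertex} => inl (i, (Some 0%R, w)) \in A) eqE.
rewrite !inE /= !mul0r !subr0 !eqxx => /andP[_ /eqP ->] /andP[/eqP -> /eqP ->].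
by [].
Qed.

Lemma card_pad_edge z : #|pad_edge z| = #|F|.+1 + m.
Proof.
case: z => i p.
pose h (x : option F + 'I_m) : pad_vertex :=
  match x with inl o => inl (i, (o, intercept o p)) | inr j => inr (p, j) end.
have -> : #|F|.+1 + m = #|{: option F + 'I_m}|.
  by rewrite card_sum card_option card_ord.
rewrite -(card_codom (f := h)); last first.
  by move=> [o|j] [o'|j'] //= [] ->.
apply: eq_card => v; rewrite inE; apply/idP/codomP.
  case: v => [[i' [o b]]|[p' j]] /=.
    by case/andP => /eqP -> /eqP <-; exists (inl o).
  by move/eqP => ->; exists (inr j).
by case=> -[o|j] -> /=; rewrite !eqxx.
Qed.

Lemma deg_pad (C : hypergraph pad_vertex) v : C \subset pad_graph ->
  deg C v = #|[set z | (pad_edge z \in C) && (v \in pad_edge z)]|.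
Proof.
move=> CH; rewrite -(card_imset _ pad_edge_inj); apply: eq_card => e.
apply/idP/imsetP => [|[z]]; last by rewrite !inE => /andP[zC vz] ->; rewrite zC inE.
rewrite inE => /andP[eC ve]; have /imsetP [z _ ez] := subsetP CH _ eC.
by exists z; rewrite // inE -ez eC ve.
Qed.

Lemma deg_pad_line (C : hypergraph pad_vertex) i o b : C \subset pad_graph ->
  deg C (inl (i, (o, b))) = line_count [set p | pad_edge (i, p) \in C] o b.
Proof.
move=> CH; rewrite deg_pad // /line_count.
rewrite -(card_imset _ (_ : injective (fun p : F * F => (i, p)))); last by move=> ? ? [].
apply: eq_card => -[i' p]; rewrite !inE /=; apply/idP/imsetP.
  case/and3P => zC /eqP ei pb; rewrite -ei in zC *.
  by exists p; rewrite // !inE zC pb.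
by case=> p'; rewrite !inE => /andP[zC pb] [-> ->]; rewrite zC eqxx.
Qed.

Lemma pad_regular : regular #|F| pad_graph.
Proof.
move=> [[i [o b]]|[p j]].
  rewrite deg_pad_line // /line_count -(card_line o b); apply: eq_card => p.
  by rewrite !inE imset_f.
rewrite deg_pad // -(card_imset _ (_ : injective (fun i : F => (i, p)))); last by move=> ? ? [].
apply: eq_card => -[i' p']; rewrite !inE imset_f //=; apply/eqP/imsetP.
  by move=> ->; exists i'.
by case=> i _ [_ ->].
Qed.

End Padding.
End AffinePlane.

(** * The lower bound and the existence of the minimum *)

Lemma window_mono r (s t : int) : (s <= t)%R -> window r s -> window r t.
Proof.
move=> st ws d k k1 kd V H Hd Hr; have [C [CH Cs]] := ws d k k1 kd V H Hd Hr.
by exists C; split=> // v; have := Cs v; lia.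
Qed.

Lemma window_lower (r q : nat) (s : int) : 3 <= r -> 2 * q ^ 2 <= r ->
  window r s -> (q%:Z <= s)%R.
Proof.
move=> r3 qr ws; rewrite leNgt; apply/negP => sq.
(* This makes [2 ^ n < r <= 2 * 2 ^ n], so edges of size [2 ^ n + 1] can be padded to size [r]. *)
pose n := trunc_log 2 r.-1.
have n0 : 0 < n by rewrite trunc_log_gt0; lia.
have lo : 2 ^ n <= r.-1 by apply: trunc_logP; lia.
have hi : r.-1 < 2 ^ n.+1 by apply: trunc_log_ltn.
have [F _ cardF] := PrimePowerField (isT : prime 2) n0.
(* From [s < q] follows [s <= 2 * g + 1], so taking [k = M - g] centres the window at [M] with
   radius [g]. *)
pose M := 2 ^ n.-1; pose g := q.-1./2.
have QM : #|F| = M.*2 by rewrite cardF -mul2n -expnS prednK.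
have qQ : q ^ 2 <= #|F| by rewrite cardF; move: hi; rewrite expnS; lia.
have gq : 2 * g <= q.-1 by rewrite /g; lia.
have M0 : 0 < M by rewrite expn_gt0.
have gM : g < M by nia.
have ws' := window_mono (_ : s <= (2 * g).+1%:Z)%R ws.
have {}ws' := ws' ltac:(rewrite /g; lia).
have [|||C [CH Cs]] := ws' #|F| (M - g) _ _ _ (pad_graph F (r - #|F|.+1)) (@pad_regular _ _).
- by lia.
- by lia.
- move=> e /imsetP [z _ ->]; rewrite card_pad_edge; lia.
have := @line_count_deviation F [set p | pad_edge (r - #|F|.+1) (0%R, p) \in C] M g QM.
(* Writing [Q] for [#|F|], [4 * g ^ 2 <= Q - 1] bounds the left side by [Q ^ 2 - 1]. *)
have small : #|F|.+1 * (4 * g ^ 2) < #|F| ^ 2.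
  have g4 : 4 * g ^ 2 < #|F|.
    have qF : q.-1 ^ 2 < #|F|.
      by move: qQ QM M0; clear; case: q => [|q] /=; rewrite ?expnS; lia.
    have : (2 * g) ^ 2 <= q.-1 ^ 2 by rewrite leq_sqr.
    by move: qF; rewrite expnMn; exact: (fun h1 h2 => leq_ltn_trans h2 h1).
  apply: leq_ltn_trans (_ : #|F|.+1 * #|F|.-1 < _); first by rewrite leq_mul2l; lia.
  have : 0 < #|F| by rewrite QM double_gt0.
  by case: #|F| => // Q _; rewrite -mulnn /=; lia.
move: small; rewrite ltnNge => /negP large bound; apply/large/bound => o b.
have := Cs (inl (0%R, (o, b))); rewrite deg_pad_line //.
by move: gM; move: (line_count _ o b) (M) (g); clear; lia.
Qed.

Lemma floor_sqrt_nat (R : realType) (r : nat) : exists2 q : nat,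
  Num.floor (Num.sqrt (r%:R / 2%:R : R)) = q%:Z%R & 2 * q ^ 2 <= r.
Proof.
set x : R := (r%:R / 2%:R)%R; have x0 : (0 <= x)%R by rewrite divr_ge0.
have := floor_ge0 (Num.sqrt x); rewrite sqrtr_ge0 => /esym.
case E : (Num.floor _) => [q|//] _; exists q => //.
have := floor_le_tmp (Num.sqrt x); rewrite E => qle.
have : ((q%:R : R) ^+ 2 <= x)%R by rewrite -(sqr_sqrtr x0) lerXn2r ?nnegrE ?sqrtr_ge0.
by rewrite ler_pdivlMr ?ltr0n // -natrX -natrM ler_nat mulnC.
Qed.

Theorem theorem1p4 (R : realType) (r : nat) (hr : 3 <= r) :
  exists g : int, is_g r g /\
    (Num.floor (Num.sqrt (r%:R / 2%:R : R)) <= g <= 2 * r%:Z - 3)%R.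
Proof.
have winE : ((2 * r - 3)%N%:Z = 2 * r%:Z - 3)%R by lia.
have upper : `[< window r (2 * r - 3)%N >] by apply/asboolP; rewrite winE; exact: window_upper.
have exW : exists n : nat, `[< window r n >] by exists (2 * r - 3).
case: (ex_minnP exW) => n /asboolP wn nmin.
have [q -> qr] := floor_sqrt_nat R r.
exists n%:Z%R; split; last first.
  by rewrite (window_lower hr qr wn) -winE lez_nat nmin.
split=> // s ws.
(* With [q = 0] the lower bound rules out negative [s], so the least natural window length is least
   among integers. *)
have : (0 <= s)%R by apply: (window_lower (q := 0) hr _ ws).
by case: s ws => // s /asboolP/nmin; rewrite lez_nat.
Qed.
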